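(* Let $X$ be an infinite set. The dual Baer-Levi semigroup $\mathrm{DBL}_X$ has left diameter $2$.
   Context: Maps are written on the right and composed from left to right. $\mathrm{DBL}_X$ is the semigroup (under composition) of all surjective maps $\alpha:X\to X$ such that $|x\alpha^{-1}|=|X|$ for all $x\in X$. Left diameter. For a semigroup $S$, $S^1$ is $S$ with an identity adjoined if $S$ has none ($S^1=S$ if $S$ is a monoid). A left congruence on $S$ is an equivalence relation $\rho$ such that $(a,b)\in\rho$ implies $(sa,sb)\in\rho$ for all $s\in S$; $\langle U\rangle$ denotes the smallest left congruence containing $U\subseteq S\times S$. The universal relation $S\times S$ viewed as a left congruence is denoted $\omega_S^l$; it is finitely generated if $\omega_S^l=\langle U\rangle$ for some finite $U\subseteq S\times S$. A $U$-sequence of length $n\geq 1$ from $a$ to $b$ is a sequence $a=s_1u_1,\ s_1v_1=s_2u_2,\ \dots,\ s_nv_n=b$ where, for each $i$, $(u_i,v_i)\in U$ or $(v_i,u_i)\in U$, and $s_i\in S^1$; if $a=b$ then $a,b$ are related by a $U$-sequence of length $0$. If $\omega_S^l=\langle U\rangle$, let $d_U^l(a,b)$ be the least length of a $U$-sequence from $a$ to $b$ and $D_l(U,S)=\sup\{d_U^l(a,b):a,b\in S\}$. If $\omega_S^l$ is finitely generated, the left diameter of $S$ is $D_l(S)=\min\{D_l(U,S): \omega_S^l=\langle U\rangle,\ U\text{ finite}\}$. Saying ''$S$ has left diameter $n$'' means $\omega_S^l$ is finitely generated and $D_l(S)=n$. *)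

(* Defs.v *)
From HB Require Import structures.
From mathcomp Require Import all_boot all_order.
From mathcomp Require Import boolp classical_sets functions cardinality.

Set Implicit Arguments.
Unset Strict Implicit.
Unset Printing Implicit Defensive.

Local Open Scope classical_set_scope.
Local Open Scope group_scope.

Definition least (A : set nat) (n : nat) : Prop := A n /\ lbound A n.

Section LeftDiameter.
Variable S : semigroupType.

Definition has_identity : Prop :=
  exists e : S, left_id e (@mul S) /\ right_id e (@mul S).

(* S^1 as a subset of option S: the extra element None, which acts as an       *)
(* identity, belongs to it only when S is not already a monoid.                *)
Definition S1 : set (option S) := [set s | s = None -> ~ has_identity].

Definition act1 (s : option S) (a : S) : S := if s is Some t then t * a else a.

Definition left_congruence (R : set (S * S)) : Prop :=
  [/\ forall a, R (a, a),
      forall a b, R (a, b) -> R (b, a),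
      forall a b c, R (a, b) -> R (b, c) -> R (a, c)
    & forall s a b, R (a, b) -> R (s * a, s * b)].

Definition left_congruence_gen (U : set (S * S)) : set (S * S) :=
  smallest left_congruence U.

Definition generates_universal (U : set (S * S)) : Prop :=
  [set: S * S] = left_congruence_gen U.

Definition universal_left_congruence_fg : Prop :=
  exists U : set (S * S), finite_set U /\ generates_universal U.

Fixpoint Useq (U : set (S * S)) (n : nat) (a b : S) : Prop :=
  if n is m.+1 then
    exists s u v, [/\ S1 s, U (u, v) \/ U (v, u), a = act1 s u
                    & Useq U m (act1 s v) b]
  else a = b.

Definition left_dist (U : set (S * S)) (a b : S) : nat -> Prop :=
  least [set n | Useq U n a b].

(* D_l(U, S) = n for a natural number n; no n satisfies this when the          *)
(* distances are unbounded, i.e. when D_l(U, S) is infinite.                   *)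
Definition left_diameter_wrt (U : set (S * S)) (n : nat) : Prop :=
  supremums [set d : nat | exists a b, left_dist U a b d] n.

(* Generating sets with infinite D_l(U, S) contribute nothing to the set below,*)
(* which does not affect a minimum that is a natural number.                   *)
Definition has_left_diameter (n : nat) : Prop :=
  universal_left_congruence_fg /\
  least [set d | exists U : set (S * S),
           [/\ finite_set U, generates_universal U & left_diameter_wrt U d]] n.

End LeftDiameter.

Section DualBaerLevi.
Variable X : Type.

Definition dbl_set : set (X -> X) :=
  [set f | set_surj [set: X] [set: X] f /\
           forall x, (f @^-1` [set x] #= [set: X])%card].

Definition DBL : Type := set_type dbl_set.

HB.instance Definition _ := gen_eqMixin DBL.
HB.instance Definition _ := gen_choiceMixin DBL.

Lemma dbl_comp (f g : X -> X) : dbl_set f -> dbl_set g -> dbl_set (g \o f).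
Proof.
move=> [fs fc] [gs gc]; split=> [z _|z].
  have [y _ <-] := gs z I; have [x _ <-] := fs y I.
  by exists x.
rewrite card_eq_le card_leT /=.
have [y _ gy] := gs z I.
have := fc y; rewrite card_eq_le => /andP[_ /card_le_trans]; apply.
by apply: subset_card_le => x /= ->.
Qed.

(* Maps are written on the right: the product of f and g is "f, then g".       *)
Definition dbl_mul (f g : DBL) : DBL :=
  SigSub (mem_set (dbl_comp (set_mem (valP f)) (set_mem (valP g)))).

Lemma dbl_mulA : associative dbl_mul.
Proof. by move=> f g h; apply: val_inj. Qed.

HB.instance Definition _ := isSemigroup.Build DBL dbl_mulA.

End DualBaerLevi.

(* Main.v *)
Require Import Defs.
From HB Require Import structures.
From mathcomp Require Import all_boot all_order.
From mathcomp Require Import boolp classical_sets functions cardinality wochoice.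

(** Fix a bijection X = X * X and let u, v be its two coordinate maps, which
    lie in DBL_X.  A pair (a, c) has the form (s u, s v) exactly when the map
    x |-> (x a, x c), read back in X, belongs to DBL_X; in other words when
    every fibre of a meets every fibre of c in a set of size |X|
    ([dbl_pair_factor]).  So a and c are then one step apart for the single
    generating pair (u, v).

    Given arbitrary a and b, one single c stands in this relation to both
    ([dbl_common_complement]): the fibres of a and of b form a family of at
    most |X| sets of size |X|, and such a family can be split simultaneously
    by a map c all of whose values are taken |X| times on each member
    ([large_splitting]).  Going from a to c and back to b takes two steps.
    The splitting comes from a transfinite choice of distinct representatives
    along an order in which all initial segments are smaller than X
    ([card_transversal], [initial_order]).  It also relies on |X * X| = |X|
    ([card_square]), proved by comparing X with the order on pairs that first
    compares maxima.

    One step is never enough, whatever the finite set U ([dbl_far_pair]).  If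
    (a, b) = (s u, s v), then b is constant on a fibre of a only if v is
    constant on the corresponding fibre of u, with the same value.  Fixing x0,
    each (u, v) in U or its converse hence determines at most one k such that b
    sends the fibre of a over x0 to k, for some pair (a, b) arising from (u, v)
    in one step.  As X is infinite, some k differs from x0 and from these
    finitely many values, and it is realized by an a in DBL_X followed by a
    surjection that moves x0 to k. *)

Set Implicit Arguments.
Unset Strict Implicit.
Unset Printing Implicit Defensive.
Local Open Scope classical_set_scope.
Local Open Scope card_scope.

(** * Injections and cardinals *)

Lemma card_le_inj {T U : Type} {A : set T} {B : set U} (f : T -> U) :
  set_fun A B f -> set_inj A f -> A #<= B.
Proof.
move=> fAB /inj_card_eq /card_esym /card_eqPle [leAf _].
by apply: (card_le_trans leAf); apply: subset_card_le => _ [x Ax <-]; exact: fAB.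
Qed.

Lemma card_le_injE {T U : Type} (u0 : U) {A : set T} {B : set U} :
  A #<= B -> exists2 f : T -> U, set_fun A B f & set_inj A f.
Proof.
elim/Ppointed: U u0 B => U u0 B; first by case: (no u0).
by move=> /pcard_leP/injfunPex.
Qed.

Lemma card_leX {T U V W : Type} (u0 : U) (w0 : W)
    {A : set T} {B : set U} {C : set V} {D : set W} :
  A #<= B -> C #<= D -> A `*` C #<= B `*` D.
Proof.
move=> /(card_le_injE u0)[f fAB finj] /(card_le_injE w0)[g gCD ginj].
apply: (card_le_inj (f := fun p => (f p.1, g p.2))).
  by move=> [a c] [/= Aa Cc]; split; [exact: fAB|exact: gCD].
move=> [a c] [a' c'] /set_mem [/= Aa Cc] /set_mem [/= Aa' Cc'] [].
move=> /(finj _ _ (mem_set Aa) (mem_set Aa'))->.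
by move=> /(ginj _ _ (mem_set Cc) (mem_set Cc'))->.
Qed.

(** An infinite set contains a copy of the natural numbers; shifting that copy
    by one frees a place for the new point. *)
Lemma card_leU1 {T : Type} (m : T) {A : set T} :
  infinite_set A -> A `|` [set m] #<= A.
Proof.
move=> /infiniteP /(card_le_injE m)[h hA hinj].
have {}hA n : A (h n) by exact: hA.
have {}hinj n k : h n = h k -> n = k by apply: hinj; rewrite in_setT.
pose shift x := if pselect (exists n, h n = x) is left e
  then h (projT1 (cid e)).+1 else x.
have shift_h n : shift (h n) = h n.+1.
  rewrite /shift; case: pselect => [e|[]]; last by exists n.
  by case: cid => k /= /hinj ->.
have shift_out x : ~ (exists n, h n = x) -> shift x = x.
  by rewrite /shift; case: pselect.
pose f x := if `[< x = m >] then h 0 else shift x.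
have fm : f m = h 0 by rewrite /f asboolT.
have fNm x : x <> m -> f x = shift x by move=> xm; rewrite /f asboolF.
have [Am|nAm] := pselect (A m).
  by apply: subset_card_le => x [|->].
have shiftA x : A x -> A (shift x).
  by have [[n <-]|/shift_out -> //] := pselect (exists n, h n = x); rewrite shift_h.
apply: (card_le_inj (f := f)) => [x [Ax|->]|x y].
- by rewrite fNm => [|xm]; [exact: shiftA|rewrite xm in Ax].
- by rewrite fm.
have shift0 z : ~ (shift z = h 0).
  have [[n <-]|nz] := pselect (exists n, h n = z).
    by rewrite shift_h => /hinj.
  by rewrite shift_out// => zh; apply: nz; exists 0.
move=> _ _.
have [->|/fNm->] := pselect (x = m); have [->|/fNm->] := pselect (y = m) => //.
- by rewrite fm => /esym /shift0.
- by rewrite fm => /shift0.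
have [[n <-]|nx] := pselect (exists n, h n = x);
  have [[k <-]|ny] := pselect (exists n, h n = y).
- by rewrite !shift_h => /hinj [->].
- by rewrite shift_h (shift_out y)// => hy; case: ny; exists n.+1.
- by rewrite shift_h (shift_out x)// => hx; case: nx; exists k.+1.
- by rewrite !shift_out.
Qed.

(** * Well-orders and transversals *)

Definition strict_wo {T : Type} (lt : T -> T -> Prop) :=
  [/\ well_founded lt,
      forall x y z, lt x y -> lt y z -> lt x z
    & forall x y, [\/ lt x y, x = y | lt y x]].

Lemma strict_wo_exists (T : Type) : exists lt : T -> T -> Prop, strict_wo lt.
Proof.
have [R Rwo] := well_ordering_principle {classic T}.
have minR (A : set {classic T}) x : A x ->
    exists2 z, A z & forall y, A y -> R z y.
  move=> Ax; have [|z [[Az zmin] _]] := Rwo (mem A); first by exists x; rewrite inE.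
  by exists z => [|y Ay]; [rewrite inE in Az|apply: zmin; rewrite inE].
have RwoT : wo_chain R predT by exact: withinW.
have Rtot x y : R x y \/ R y x by apply/orP; exact: (wo_chainW RwoT).
have Ranti x y : R x y -> R y x -> x = y.
  by move=> xy yx; apply: (wo_chain_antisymmetric RwoT) => //; rewrite xy.
exists (fun x y => ~ R y x); split.
- move=> x; apply: contrapT => nAx.
  have [z nAz zmin] := minR [set x | ~ Acc _ x] x nAx.
  by apply: nAz; split=> y nzy; apply: contrapT => /zmin.
- move=> x y z nyx nzy zx.
  have [w] := minR [set x; y; z] x (or_introl (or_introl erefl)).
  move=> [[->|->]|->] wmin.
  + have Rxy : R x y by have [] := Rtot x y.
    by apply: nzy; rewrite -(Ranti x z) //; apply: wmin; right.
  + by apply: nyx; apply: wmin; left; left.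
  + by apply: nzy; apply: wmin; left; right.
- move=> x y.
  have [Ryx|nyx] := pselect (R y x); last by constructor 1.
  have [Rxy|nxy] := pselect (R x y); last by constructor 3.
  by constructor 2; exact: Ranti.
Qed.

Definition below {T : Type} (lt : T -> T -> Prop) (x : T) : set T :=
  [set y | lt y x].

(** Representatives are picked by recursion along the order: the ones picked
    before stage i are too few to exhaust [F i]. *)
Lemma card_transversal {I Y : Type} (lt : I -> I -> Prop) (y0 : Y)
    (D : set I) (F : I -> set Y) :
  strict_wo lt ->
  (forall i, D i -> ~ (F i #<= below lt i)) ->
  exists2 f : I -> Y, (forall i, D i -> F i (f i)) & set_inj D f.
Proof.
move=> [wf _ tri] big.
pose fresh i (g : forall j, lt j i -> Y) :=
  [set y | F i y /\ forall j (ji : lt j i), g j ji <> y].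
pose step i g := if pselect (fresh i g !=set0) is left e then projT1 (cid e) else y0.
pose f := Fix wf (fun=> Y) step.
have fE i : f i = step i (fun j _ => f j).
  apply: Fix_eq => {}i g h gh; congr step.
  by apply: functional_extensionality_dep => j; apply: functional_extensionality_dep.
have f_fresh i : D i -> fresh i (fun j _ => f j) (f i).
  move=> /big nF; rewrite fE /step; case: pselect => /= [e|]; first by case: cid.
  move=> nfresh; case: nF; apply: (card_le_trans _ (card_image_le f _)).
  apply: subset_card_le => y Fy; apply: contrapT => ny; apply: nfresh; exists y.
  by split=> // j ji fjy; apply: ny; exists j.
exists f => [i /f_fresh[]//|i j /set_mem Di /set_mem Dj fij].
have [_ fi] := f_fresh i Di; have [_ fj] := f_fresh j Dj.
by case: (tri i j) => // [/fj|/fi]; rewrite fij.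
Qed.

(** Taking for m the maximum of a pair gives the order on pairs that compares
    maxima before anything else. *)
Lemma strict_wo_lex {T M : Type} (m : T -> M) ltM ltT :
  strict_wo ltM -> strict_wo ltT ->
  strict_wo (fun p q : T => ltM (m p) (m q) \/ m p = m q /\ ltT p q).
Proof.
move=> [wfM trM triM] [wfT trT triT]; split.
- move=> p; move: {2}(m p) (erefl (m p)) => x.
  elim/(well_founded_ind wfM): x p => x IHx p.
  elim/(well_founded_ind wfT): p => p IHp px; split=> q [|[qp ltqp]].
    by rewrite px => /IHx/(_ _ erefl).
  by apply: IHp => //; rewrite qp.
- move=> p q r [pq|[pq ltpq]] [qr|[qr ltqr]].
  + by left; exact: trM qr.
  + by left; rewrite -qr.
  + by left; rewrite pq.
  + by right; split; [rewrite pq|exact: trT ltqr].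
- move=> p q; case: (triM (m p) (m q)) => [pq|pq|qp].
  + by constructor 1; left.
  + case: (triT p q) => [lt|->|lt];
      by [constructor 1; right|constructor 2|constructor 3; right].
  + by constructor 3; left.
Qed.

Lemma strict_wo_pull {T U : Type} (f : T -> U) lt :
  strict_wo lt -> injective f -> strict_wo (fun x y => lt (f x) (f y)).
Proof.
move=> [wf tr tri] finj; split.
- move=> x; move: {2}(f x) (erefl (f x)) => u.
  elim/(well_founded_ind wf): u x => u IH x xu.
  by split=> y; rewrite xu => /IH/(_ _ erefl).
- by move=> x y z; exact: tr.
- move=> x y; case: (tri (f x) (f y)) => [|/finj|];
    by [constructor 1|constructor 2|constructor 3].
Qed.

(** If some initial segment of a well-order is as large as T, take the least
    such segment and pull the order back along an injection of T into it. *)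
Lemma initial_order (T : Type) :
  exists2 lt : T -> T -> Prop, strict_wo lt & forall x, ~ ([set: T] #<= below lt x).
Proof.
have [lt ltwo] := strict_wo_exists T; have [wf tr _] := ltwo.
have [[x0 Tx0]|nT] := pselect (exists x, [set: T] #<= below lt x); last first.
  by exists lt => // x Tx; apply: nT; exists x.
elim/(well_founded_ind wf): x0 Tx0 => x IH Tx.
have [[y yx Ty]|nT] := pselect (exists2 y, lt y x & [set: T] #<= below lt y).
  exact: IH Ty.
have [g gx ginj] := card_le_injE x Tx.
have {}ginj : injective g by move=> y z; apply: ginj; rewrite in_setT.
exists (fun y z => lt (g y) (g z)); first exact: strict_wo_pull.
move=> y Ty; apply: nT; exists (g y); first exact: gx.
apply: card_le_trans Ty _; apply: (card_le_inj (f := g)) => // u v _ _; exact: ginj.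
Qed.

(** * Squares of infinite sets *)

(** Pairs in A are ordered by their maximum first, ties being broken by an
    arbitrary well-order.  The predecessors of a pair p lie in [J `*` J], where
    J consists of the elements up to the maximum of p.  Either J is finite, or
    its square is no larger than the segment below that maximum; in both cases
    the predecessors of p are fewer than A, so distinct elements of A can be
    assigned to all pairs. *)
Lemma card_square_step {T : Type} (lt : T -> T -> Prop) (A : set T) :
  strict_wo lt -> infinite_set A ->
  (forall x, A x -> ~ (A #<= below lt x)) ->
  (forall x, A x -> infinite_set (below lt x) ->
     below lt x `*` below lt x #<= below lt x) ->
  A `*` A #<= A.
Proof.
move=> ltwo Ainf small square; have [_ tr tri] := ltwo.
have [a0 _] := infinite_setN0 Ainf.
have [lt2 lt2wo] := strict_wo_exists (T * T).
pose top (p : T * T) := if `[< lt p.1 p.2 >] then p.2 else p.1.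
have top1 p : (below lt (top p) `|` [set top p]) p.1.
  by rewrite /top; case: asboolP => ?; [left|right].
have top2 p : (below lt (top p) `|` [set top p]) p.2.
  rewrite /top; case: asboolP => ?; first by right.
  by case: (tri p.1 p.2) => // [e|?]; [right; rewrite e|left].
have topA p : (A `*` A) p -> A (top p) by rewrite /top => -[]; case: asboolP.
have [p Ap|f fA finj] := card_transversal (D := A `*` A) (F := fun=> A) a0
    (strict_wo_lex top ltwo lt2wo); last exact: card_le_inj fA finj.
move=> Ale.
set J := below lt (top p) `|` [set top p].
have downJ x y : lt x y -> J y -> J x.
  by move=> xy [yp|ym]; left; [exact: tr yp|rewrite ym in xy].
have leJ : A #<= J `*` J.
  apply: card_le_trans Ale _; apply: subset_card_le => q qp.
  have Jtop : J (top q) by case: qp => [|[->]]; [left|right].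
  have Jq x : (below lt (top q) `|` [set top q]) x -> J x.
    by case=> [/downJ/(_ Jtop)//|->].
  by split; apply: Jq; [exact: top1|exact: top2].
have [finB|infB] := pselect (finite_set (below lt (top p))).
  apply: Ainf; apply: card_le_finite leJ _; apply: finite_setX;
    by rewrite finite_setU; split=> //; exact: finite_set1.
apply: (small _ (topA _ Ap)); apply: card_le_trans leJ _.
apply: (card_le_trans _ (square _ (topA _ Ap) infB)).
exact: (card_leX a0 a0 (card_leU1 (top p) infB) (card_leU1 (top p) infB)).
Qed.

(** Induction on the initial segments of an order of minimal type: a segment
    as large as an earlier one inherits its square bound, and any other one
    falls under [card_square_step]. *)
Theorem card_square (X : Type) : infinite_set [set: X] ->
  [set: X * X] #<= [set: X].
Proof.
move=> Xinf; rewrite -setXTT.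
have [lt ltwo small] := initial_order X; have [wf tr _] := ltwo.
apply: (card_square_step ltwo Xinf) => [x _|x _]; first exact: small.
elim/(well_founded_ind wf): x => x IH inf.
have [[y yx xy]|nx] := pselect (exists2 y, lt y x & below lt x #<= below lt y).
  have infy : infinite_set (below lt y) by move=> /(card_le_finite xy).
  apply: card_le_trans (card_leX x x xy xy) _.
  apply: card_le_trans (IH y yx infy) _; apply: subset_card_le => z zy; exact: tr yx.
by apply: (card_square_step ltwo inf) => [y yx ?|]; [apply: nx; exists y|exact: IH].
Qed.

(** * Splitting a family of large sets *)

(** Distinct representatives are chosen for the family repeating each [F i]
    once for every (v, n) in [X * X]; the value v is prescribed on the
    representatives attached to v, and there is one for each n. *)
Lemma large_splitting {X I : Type} (F : I -> set X) :
  infinite_set [set: X] -> [set: I] #<= [set: X] ->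
  (forall i, [set: X] #<= F i) ->
  exists c : X -> X, forall i v, [set: X] #<= F i `&` c @^-1` [set v].
Proof.
move=> Xinf IX XF; have [x0 _] := infinite_setN0 Xinf.
have [lt ltwo small] := initial_order X.
have KX : [set: I * (X * X)] #<= [set: X].
  have := card_leX x0 x0 IX (card_square Xinf); rewrite !setXTT => le.
  exact: card_le_trans le (card_square Xinf).
have [k _ kinj] := card_le_injE x0 KX.
have {}kinj : injective k by move=> p q; apply: kinj; rewrite in_setT.
have [p _ Fp|f fF finj] := card_transversal (D := setT) (F := fun p => F p.1) x0
    (strict_wo_pull ltwo kinj).
  apply: (small (k p)); apply: card_le_trans (XF p.1) _; apply: card_le_trans Fp _.
  by apply: (card_le_inj (f := k)) => [q|q r _ _ /kinj].
have {}finj : injective f by move=> p q; apply: finj; rewrite in_setT.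
pose c x := if pselect (exists p, f p = x) is left e
  then (projT1 (cid e)).2.1 else x0.
have cf p : c (f p) = p.2.1.
  rewrite /c; case: pselect => [e|[]]; last by exists p.
  by case: cid => q /= /finj ->.
exists c => i v; apply: (card_le_inj (f := fun n => f (i, (v, n)))).
  by move=> n _; split; [exact: (fF (i, (v, n)))|exact: cf].
by move=> n n' _ _ /finj [].
Qed.

Lemma card_bool_prod {X : Type} :
  infinite_set [set: X] -> [set: bool * X] #<= [set: X].
Proof.
move=> Xinf; have [x0 _] := infinite_setN0 Xinf.
have [x1 [_ x10]] := infinite_setN0 (infinite_setD Xinf (finite_set1 x0)).
apply: (card_le_trans _ (card_square Xinf)).
apply: (card_le_inj (f := fun p => (if p.1 then x0 else x1, p.2))) => //.
move=> [b x] [b' x'] _ _ [+ ->]; by case: b b' => -[] // x01; case: x10; rewrite x01.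
Qed.

Lemma square_bijection {X : Type} :
  infinite_set [set: X] -> exists e : X -> X * X, bijective e.
Proof.
elim/Ppointed: X => X Xinf; first by case: Xinf; rewrite emptyE.
have /card_set_bijP[e] : [set: X] #= [set: X * X].
  apply: Cantor_Bernstein (card_square Xinf).
  by apply: (card_le_inj (f := fun x => (x, x))) => // x y _ _ [].
by rewrite setTT_bijective; exists e.
Qed.

(** * Sequences and left diameter in a semigroup *)

Section Semigroup.
Variable S : semigroupType.
Implicit Types (U : set (S * S)) (a b c : S).

Lemma useq_cat U m n a b c : Useq U m a b -> Useq U n b c -> Useq U (m + n) a c.
Proof.
elim: m a => [|m IH] a /= => [->//|[s [u [v [Ss Uuv -> sv]]]] bc].
by exists s, u, v; split=> //; exact: IH.
Qed.

Lemma useq1_sym U a b : Useq U 1 a b -> Useq U 1 b a.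
Proof.
move=> [s [u [v [Ss Uuv -> svb]]]]; exists s, v, u; split=> //.
by case: Uuv; [right|left].
Qed.

Lemma useq_sym U n a b : Useq U n a b -> Useq U n b a.
Proof.
elim: n a => [|n IH] a; first by move=> /esym.
move=> [s [u [v [Ss Uuv au svb]]]]; rewrite -addn1; apply: (useq_cat (IH _ svb)).
by apply: useq1_sym; exists s, u, v.
Qed.

Lemma useq_mul U n t a b : Useq U n a b -> Useq U n (t * a)%g (t * b)%g.
Proof.
elim: n a => [|n IH] a /= => [->//|[s [u [v [Ss Uuv -> /IH svb]]]]].
case: s Ss svb => [s|] _ svb.
  by exists (Some (t * s)%g), u, v; split; rewrite //= -?monoid.mulgA.
by exists (Some t), u, v; split.
Qed.

(** When S is a monoid the formal identity is excluded, so the identity of S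
    has to serve as multiplier. *)
Lemma useq_base U u v : U (u, v) -> Useq U 1 u v.
Proof.
move=> Uuv; have [[e [el er]]|ne] := pselect (has_identity S).
  by exists (Some e), u, v; split; rewrite //= ?el //; left.
by exists None, u, v; split=> //; left.
Qed.

Lemma act1_congruence (R : set (S * S)) s a b :
  left_congruence R -> R (a, b) -> R (act1 s a, act1 s b).
Proof. by case: s => //= t [_ _ _ Rmul]; exact: Rmul. Qed.

Lemma useq_congruence U (R : set (S * S)) n a b :
  left_congruence R -> U `<=` R -> Useq U n a b -> R (a, b).
Proof.
move=> Rcong UR; have [Rrefl Rsym Rtrans _] := Rcong.
elim: n a => [a -> //|n IH a [s [u [v [_ Uuv -> /IH]]]]].
by apply: Rtrans; apply: act1_congruence => //; case: Uuv => /UR // /Rsym.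
Qed.

(** Being joined by a sequence is itself a left congruence containing U. *)
Lemma generates_universalP U :
  generates_universal U <-> forall a b, exists n, Useq U n a b.
Proof.
split=> [gen a b|useq].
  have : left_congruence_gen U (a, b) by rewrite -gen.
  apply: (_ : left_congruence_gen U `<=` [set p | exists n, Useq U n p.1 p.2]).
  apply: smallest_sub => [|[u v] Uuv]; last by exists 1%N; exact: useq_base.
  split=> /= [x|x y [n xy]|x y z [m xy] [n yz]|t x y [n xy]].
  - by exists 0%N.
  - by exists n; exact: useq_sym.
  - by exists (m + n)%N; exact: useq_cat yz.
  - by exists n; exact: useq_mul.
apply/esym; rewrite -subTset => -[a b] _ R [Rcong UR].
by have [n] := useq a b; exact: useq_congruence.
Qed.

Lemma left_dist_exists U n a b :
  Useq U n a b -> exists2 d, left_dist U a b d & (d <= n)%N.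
Proof.
move=> abn; have ex : exists k, `[< Useq U k a b >] by exists n; apply/asboolP.
case: (ex_minnP ex) => d /asboolP abd dmin.
exists d; last by apply: dmin; apply/asboolP.
by split=> // k abk; rewrite leEnat; apply: dmin; apply/asboolP.
Qed.

(** A generating U joins the two far points by some sequence, so their distance
    exists and is one of the values that the supremum has to bound. *)
Lemma has_left_diameter_bounds n :
  (exists2 U, finite_set U & forall a b, Useq U n a b) ->
  (forall U, finite_set U -> exists a b, forall m, Useq U m a b -> (n <= m)%N) ->
  has_left_diameter S n.
Proof.
move=> [U0 finU0 useqU0] far.
have genU0 : generates_universal U0.
  by apply/generates_universalP => a b; exists n.
have far_dist U : finite_set U -> generates_universal U ->
    exists2 d, [set d | exists a b, left_dist U a b d] d & (n <= d)%N.
  move=> finU /generates_universalP gen; have [a [b ab]] := far U finU.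
  have [k /left_dist_exists[d abd _]] := gen a b.
  by exists d; [exists a, b|apply: ab; case: abd].
split; first by exists U0.
split=> [|d [U [finU gen [ubd _]]]]; last first.
  by have [k /ubd kd nk] := far_dist U finU gen; exact: leq_trans kd.
exists U0; split=> //; split.
  by move=> d [a [b [_ lbd]]]; exact: lbd (useqU0 a b).
by move=> d ubd; have [k /ubd kd nk] := far_dist U0 finU0 genU0; exact: leq_trans kd.
Qed.

End Semigroup.

(** * The dual Baer-Levi semigroup *)

Lemma dbl_setP {X : Type} (f : X -> X) :
  (forall x, [set: X] #<= f @^-1` [set x]) -> dbl_set f.
Proof.
move=> fX; split=> [x _|x]; last by rewrite card_eq_le card_leT fX.
apply: contrapT => nx; have := fX x; suff -> : f @^-1` [set x] = set0.
  by rewrite card_le0 => /eqP X0; have : [set: X] x by []; rewrite X0.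
by rewrite -subset0 => y /= fy; apply: nx; exists y.
Qed.

Definition mkDBL {X : Type} (f : X -> X) (fP : dbl_set f) : DBL X :=
  SigSub (mem_set fP).

Lemma dbl_fibre {X : Type} (a : DBL X) x : [set: X] #<= val a @^-1` [set x].
Proof.
by have [_ /(_ x)] := set_mem (valP a); rewrite card_eq_le => /andP[].
Qed.

Lemma dbl_surj {X : Type} (a : DBL X) x : exists y, val a y = x.
Proof. by have [/(_ x I) [y _ <-] _] := set_mem (valP a); exists y. Qed.

Section Pairing.
Variables (X : Type) (e : X -> X * X) (d : X * X -> X).
Hypotheses (ed : cancel e d) (de : cancel d e).

Lemma dbl_fst : dbl_set (fst \o e).
Proof.
apply: dbl_setP => x; apply: (card_le_inj (f := fun y => d (x, y))).
  by move=> y _ /=; rewrite de.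
by move=> y z _ _ /(can_inj de) [].
Qed.

Lemma dbl_snd : dbl_set (snd \o e).
Proof.
apply: dbl_setP => x; apply: (card_le_inj (f := fun y => d (y, x))).
  by move=> y _ /=; rewrite de.
by move=> y z _ _ /(can_inj de) [].
Qed.

(** The factor s is the map x |-> (x a, x c) read in X through the bijection;
    its fibres are the intersections of a fibre of a with one of c. *)
Lemma dbl_pair_factor (a c : DBL X) :
  (forall y z, [set: X] #<= val a @^-1` [set y] `&` val c @^-1` [set z]) ->
  exists s : DBL X, a = (s * mkDBL dbl_fst)%g /\ c = (s * mkDBL dbl_snd)%g.
Proof.
move=> ac; have sP : dbl_set (fun x => d (val a x, val c x)).
  apply: dbl_setP => w; rewrite -[w]ed; case: (e w) => y z.
  apply: card_le_trans (ac y z) _; apply: subset_card_le => x [/= <- <-] //.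
exists (mkDBL sP).
by split; apply: val_inj; apply: functional_extensionality_dep => x /=; rewrite de.
Qed.

End Pairing.

(** The fibres of a and those of b together form one family indexed by
    [bool * X], so that a single splitting serves both. *)
Lemma dbl_common_complement {X : Type} (a b : DBL X) : infinite_set [set: X] ->
  exists c : DBL X, forall y z,
    [set: X] #<= val a @^-1` [set y] `&` val c @^-1` [set z] /\
    [set: X] #<= val b @^-1` [set y] `&` val c @^-1` [set z].
Proof.
move=> Xinf.
pose F (i : bool * X) := (if i.1 then val a else val b) @^-1` [set i.2].
have [c cP] : exists c : X -> X, forall i v, [set: X] #<= F i `&` c @^-1` [set v].
  by apply: large_splitting (card_bool_prod Xinf) _ => // -[[] y]; exact: dbl_fibre.
have [x0 _] := infinite_setN0 Xinf.
have cD : dbl_set c.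
  apply: dbl_setP => z; apply: card_le_trans (cP (true, x0) z) _.
  by apply: subset_card_le => x [].
exists (mkDBL cD) => y z; split; [exact: (cP (true, y) z)|exact: (cP (false, y) z)].
Qed.

Lemma surjective_moving {X : Type} (x y : X) :
  exists2 t : X -> X, t x = y & forall z, exists w, t w = z.
Proof.
pose t z := if `[< z = x >] then y else if `[< z = y >] then x else z.
have tx : t x = y by rewrite /t asboolT.
exists t => // z.
have [->|zy] := pselect (z = y); first by exists x.
have [->|zx] := pselect (z = x); last by exists z; rewrite /t !asboolF.
have [xy|xy] := pselect (y = x); first by exists x; rewrite tx.
by exists y; rewrite /t asboolF // asboolT.
Qed.

(** A step by (u, v) from a to b sends the fibre of a over x0 through the
    fibre of u over x0, so a constant value of b there is a value of v on
    that fibre of u.  Sampling each such fibre at one point leaves finitely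
    many possible constants. *)
Lemma dbl_far_pair {X : Type} (U : set (DBL X * DBL X)) :
  infinite_set [set: X] -> finite_set U ->
  exists a b, forall m, Useq U m a b -> (2 <= m)%N.
Proof.
move=> Xinf finU; have [x0 _] := infinite_setN0 Xinf.
have [e [d _ de]] := square_bijection Xinf.
pose a : DBL X := mkDBL (dbl_fst de).
pose pre (u : DBL X) := projT1 (cid (dbl_surj u x0)).
have preP u : val u (pre u) = x0 by rewrite /pre; case: cid.
pose K := [set x0] `|` [set val p.2 (pre p.1) | p in U]
  `|` [set val p.1 (pre p.2) | p in U].
have finK : finite_set K.
  rewrite !finite_setU; split; [split|]; by [exact: finite_set1|exact: finite_image].
(* Any k outside K works; x0 is in K so that a and b are distinct. *)
have [k [_ nKk]] := infinite_setN0 (infinite_setD Xinf finK).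
have [t tx0 tsurj] := surjective_moving x0 k.
have bP : dbl_set (t \o val a).
  apply: dbl_setP => y; have [z <-] := tsurj y.
  by apply: card_le_trans (dbl_fibre a z) _; apply: subset_card_le => x /= ->.
pose b := mkDBL bP; exists a, b.
have ab y : val a y = x0 -> val b y = k by move=> /= ->.
case=> [ab0|[ab1|//]].
  have [y ay] := dbl_surj a x0; case: nKk; left; left => /=.
  by rewrite -(ab y ay) -ab0.
have [s [u [v [_ Uuv au vb]]]] := ab1.
have [y [ay b_y]] : exists y, val a y = val u (pre u) /\ val b y = val v (pre u).
  rewrite au -vb; case: s {au vb} => [s|] /=; last by exists (pre u).
  by have [y <-] := dbl_surj s (pre u); exists y.
case: nKk; rewrite -(ab y) ?ay// b_y.
case: Uuv => Uuv; first by left; right; exists (u, v).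
by right; exists (v, u).
Qed.

Theorem theorem4p11 (X : Type) (X_infinite : infinite_set [set: X]%classic) :
  has_left_diameter (DBL X) 2.
Proof.
apply: has_left_diameter_bounds; last by move=> U; exact: dbl_far_pair.
have [e [d ed de]] := square_bijection X_infinite.
pose u := mkDBL (dbl_fst de); pose v := mkDBL (dbl_snd de).
exists [set (u, v)] => [|a b]; first exact: finite_set1.
have [c cP] := dbl_common_complement a b X_infinite.
have step (a' : DBL X) :
    (forall y z, [set: X] #<= val a' @^-1` [set y] `&` val c @^-1` [set z]) ->
    Useq [set (u, v)] 1 a' c.
  move=> /(dbl_pair_factor ed de) [s [a'E cE]].
  by exists (Some s), u, v; split=> //; left.
apply: (useq_cat (m := 1) (n := 1) (b := c)); last apply: useq_sym.
  by apply: step => y z; have [] := cP y z.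
by apply: step => y z; have [] := cP y z.
Qed.
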